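(* Assume the matrix $\boldsymbol B_0(\theta)$ satisfies $$\left[\gamma(\theta)\boldsymbol B_0(\theta)\,(\cos\hat\theta,\sin\hat\theta)^\top\right]\cdot(\cos\hat\theta,\sin\hat\theta)^\top\ \ge\ \gamma(\hat\theta)^2\qquad\forall\,\theta,\hat\theta\in[-\pi,\pi].$$ Let $\eta>0$, $\sigma\in\mathbb R$, $\Delta t_m>0$, let $\vec X^m=(r^m,z^m)^\top\in\mathbb X^h$, and let $(\vec X^{m+1},\mu^{m+1})\in\mathbb X^h\times\mathbb K^h$ with $\vec X^{m+1}=(r^{m+1},z^{m+1})^\top$ be a solution of the scheme $$\frac1{\Delta t_m}\left\langle\vec X^{m+1}-\vec X^m,\ \varphi^h\vec f^{\,m+\frac12}\right\rangle-\left\langle r^m\partial_\rho\mu^{m+1},\ \partial_\rho\varphi^h\,|\partial_\rho\vec X^m|^{-1}\right\rangle=0\qquad\forall\varphi^h\in\mathbb K^h,$$ $$\begin{aligned}&\left\langle\mu^{m+1}\vec f^{\,m+\frac12},\ \vec\psi^h\right\rangle+\left\langle\gamma(\theta^{m+1}),\ \psi_1^h|\partial_\rho\vec X^{m+1}|\right\rangle+\left\langle r^m\boldsymbol B_0(\theta^m)\partial_\rho\vec X^{m+1},\ \partial_\rho\vec\psi^h\,|\partial_\rho\vec X^m|^{-1}\right\rangle\\&+\frac1{2\eta\Delta t_m}\left[(r_L^{m+1}+r_L^m)(r_L^{m+1}-r_L^m)\psi_1^h(1)+(r_0^{m+1}+r_0^m)(r_0^{m+1}-r_0^m)\psi_1^h(0)\right]\\&-\frac\sigma2\left[(r_L^{m+1}+r_L^m)\psi_1^h(1)-(r_0^{m+1}+r_0^m)\psi_1^h(0)\right]=0\qquad\forall\vec\psi^h=(\psi_1^h,\psi_2^h)^\top\in\mathbb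 X^h.\end{aligned}$$ Then $$W(\vec X^{m+1})+2\pi\Delta t_m\left\langle r^m(\partial_\rho\mu^{m+1})^2,\ |\partial_\rho\vec X^m|^{-1}\right\rangle+\frac{\pi}{\eta\Delta t_m}\left[(r_L^{m+1}+r_L^m)(r_L^{m+1}-r_L^m)^2+(r_0^{m+1}+r_0^m)(r_0^{m+1}-r_0^m)^2\right]\le W(\vec X^m).$$
   Context: $\mathbb I=[0,1]$ is divided into $J$ intervals $\mathbb I_j=[q_{j-1},q_j]$, $q_j=jh$, $h=1/J$. $\mathbb K^h$ is the space of continuous functions on $\mathbb I$ that are affine on each $\mathbb I_j$, $\mathbb K^h_0$ its subspace of functions vanishing at $0$ and $1$, and $\mathbb X^h=\mathbb K^h\times\mathbb K^h_0$. $\langle\cdot,\cdot\rangle$ is the $L^2$ inner product over $\mathbb I$ with respect to $d\rho$ (scalar or vector functions). $(a,b)^\perp=(b,-a)$. For each time level $k$: $r_0^k=r^k(0)$, $r_L^k=r^k(1)$; it is assumed that $r^k>0$ on $(0,1]$ and $|\partial_\rho\vec X^k|>0$ on each element; $\theta^k$ (mod $2\pi$, constant on each element) is defined by $\partial_\rho\vec X^k/|\partial_\rho\vec X^k|=(\cos\theta^k,\sin\theta^k)^\top$. Moreover $$\vec f^{\,m+\frac12}=-\frac16\left[2r^m\partial_\rho\vec X^m+2r^{m+1}\partial_\rho\vec X^{m+1}+r^m\partial_\rho\vec X^{m+1}+r^{m+1}\partial_\rho\vec X^m\right]^\perp .$$ $\gamma=\gamma(\theta)>0$ is a $C^2$,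 even, $2\pi$-periodic surface energy density, $\mathscr S(\theta)$ a given real-valued ($2\pi$-periodic) stability function, and $$\boldsymbol{B}_0(\theta)=\begin{pmatrix}\gamma(\theta)&-\gamma'(\theta)\\ \gamma'(\theta)&\gamma(\theta)\end{pmatrix}\begin{pmatrix}\cos2\theta&\sin2\theta\\ \sin2\theta&-\cos2\theta\end{pmatrix}+\mathscr S(\theta)\left[\frac12\boldsymbol I-\frac12\begin{pmatrix}\cos2\theta&\sin2\theta\\ \sin2\theta&-\cos2\theta\end{pmatrix}\right],$$ with $\boldsymbol I$ the $2\times2$ identity matrix. The energy at time level $k$ is $$W(\vec X^k)=2\pi\left\langle r^k,\ \gamma(\theta^k)|\partial_\rho\vec X^k|\right\rangle+\sigma\pi\left[(r_0^k)^2-(r_L^k)^2\right].$$ *)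

(* Defs.v *)
From HB Require Import structures.
From mathcomp Require Import all_boot all_order all_algebra.
From mathcomp Require Import all_classical all_reals all_analysis.
Set Implicit Arguments.
Unset Strict Implicit.
Unset Printing Implicit Defensive.
Import Order.TTheory GRing.Theory Num.Theory.
Import numFieldNormedType.Exports.
Local Open Scope classical_set_scope.
Local Open Scope ring_scope.

(* The matrix norm of the library on 'cV_2 is the sup norm, hence the explicit
   Euclidean structure below. *)

Definition vec2 (R : realType) (a b : R) : 'cV[R]_2 :=
  \col_(i < 2) (if i == 0 then a else b).

Definition mat2 (R : realType) (a b c d : R) : 'M[R]_2 :=
  \matrix_(i < 2, j < 2)
    if i == 0 then (if j == 0 then a else b) else (if j == 0 then c else d).

Definition dot (R : realType) (u v : 'cV[R]_2) : R := \sum_(i < 2) u i 0 * v i 0.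

Definition vnorm (R : realType) (u : 'cV[R]_2) : R := Num.sqrt (dot u u).

Definition perp (R : realType) (u : 'cV[R]_2) : 'cV[R]_2 :=
  vec2 (u 1 0) (- u 0 0).

Definition rcomp (R : realType) (X : R -> 'cV[R]_2) : R -> R := fun x => X x 0 0.
Definition zcomp (R : realType) (X : R -> 'cV[R]_2) : R -> R := fun x => X x 1 0.

(* Functions on [0, 1] are represented by total functions on R whose values
   outside [0, 1] are irrelevant. Element number j (0 <= j < J) is
   [node J j, node J j.+1]. *)
Definition node (R : realType) (J j : nat) : R := j%:R * J%:R^-1.

Definition affine_on (R : realType) (A : set R) (f : R -> R) : Prop :=
  exists a b : R, forall x, A x -> f x = a + b * x.

Definition Kh (R : realType) (J : nat) (f : R -> R) : Prop :=
  {within `[0, 1], continuous f} /\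
  (forall j, (j < J)%N -> affine_on `[node R J j, node R J j.+1] f).

Definition Kh0 (R : realType) (J : nat) (f : R -> R) : Prop :=
  Kh J f /\ f 0 = 0 /\ f 1 = 0.

Definition Xh (R : realType) (J : nat) (X : R -> 'cV[R]_2) : Prop :=
  Kh J (rcomp X) /\ Kh0 J (zcomp X).

(* The derivatives appearing under these integrals are the pointwise ones; they
   exist off the finitely many nodes, a Lebesgue-negligible set. *)
Definition ip (R : realType) (u v : R -> R) : R :=
  \int[lebesgue_measure]_(x in `[0, 1]) (u x * v x).

Definition ipv (R : realType) (u v : R -> 'cV[R]_2) : R :=
  \int[lebesgue_measure]_(x in `[0, 1]) dot (u x) (v x).

Definition admissible (R : realType) (J : nat) (X : R -> 'cV[R]_2) : Prop :=
  (forall x, 0 < x <= 1 -> 0 < rcomp X x) /\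
  (forall j x, (j < J)%N -> node R J j < x < node R J j.+1 ->
     0 < vnorm (derive1 X x)).

(* Being defined mod 2 pi, the angle is a relation: th is any choice of it that
   is constant on each open element. *)
Definition tangent_angle (R : realType) (J : nat) (X : R -> 'cV[R]_2)
    (th : R -> R) : Prop :=
  forall j, (j < J)%N -> exists t : R,
    forall x, node R J j < x < node R J j.+1 ->
      th x = t /\ (vnorm (derive1 X x))^-1 *: derive1 X x = vec2 (cos t) (sin t).

Definition fhalf (R : realType) (X Y : R -> 'cV[R]_2) (x : R) : 'cV[R]_2 :=
  - (6^-1 *: perp ((2 * rcomp X x) *: derive1 X x
                   + (2 * rcomp Y x) *: derive1 Y x
                   + rcomp X x *: derive1 Y x + rcomp Y x *: derive1 X x)).

Definition periodic2pi (R : realType) (g : R -> R) : Prop :=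
  forall x, g (x + 2 * pi) = g x.

Definition C2 (R : realType) (g : R -> R) : Prop :=
  (forall x, derivable g x 1) /\ (forall x, derivable (derive1 g) x 1) /\
  continuous (derive1n 2 g).

Definition surface_energy_density (R : realType) (g : R -> R) : Prop :=
  [/\ (forall x, 0 < g x), C2 g, (forall x, g (- x) = g x) & periodic2pi g].

Definition refl (R : realType) (t : R) : 'M[R]_2 :=
  mat2 (cos (2 * t)) (sin (2 * t)) (sin (2 * t)) (- cos (2 * t)).

Definition B0 (R : realType) (g S : R -> R) (t : R) : 'M[R]_2 :=
  mat2 (g t) (- derive1 g t) (derive1 g t) (g t) *m refl t
  + S t *: (2^-1 *: 1%:M - 2^-1 *: refl t).

Definition energy (R : realType) (g : R -> R) (sigma : R)
    (X : R -> 'cV[R]_2) (th : R -> R) : R :=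
  2 * pi * ip (rcomp X) (fun x => g (th x) * vnorm (derive1 X x))
  + sigma * pi * ((rcomp X 0) ^+ 2 - (rcomp X 1) ^+ 2).

(* Main.v *)
Require Import Defs.
From HB Require Import structures.
From mathcomp Require Import all_boot all_order all_algebra.
From mathcomp Require Import all_classical all_reals all_analysis.
From mathcomp Require Import measurable_realfun ring lra.
Set Implicit Arguments.
Unset Strict Implicit.
Unset Printing Implicit Defensive.
Import Order.TTheory GRing.Theory Num.Theory.
Import numFieldNormedType.Exports.
Local Open Scope classical_set_scope.
Local Open Scope ring_scope.

(** The scheme is tested with its own solution. Taking the chemical potential
    [mu] in the first equation and the increment [Y - X] in the second, the two
    coupling terms are the same integral, so that [dt] times the dissipation,
    plus the surface terms of the second equation, plus the boundary terms,
    vanishes. The boundary terms with [eta] are those of the claim, and those with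
    [sigma] give exactly the change of the squares in the energy, because
    (a + b) (a - b) = a^2 - b^2. What remains is the one-sided comparison
    [surface_energy_estimate] between the surface terms and the change of
    surface energy.

    This comparison holds on each element separately. There the two tangents are
    constant, say m (cos t, sin t) for [X] and n (cos th, sin th) for [Y], and,
    the positive weight rX being a common factor, it amounts to
      n g(th) - m g(t) <= m^-1 B0(t) Y' . (Y' - X')
    ([element_energy]). The key fact is that B0(t) is symmetric, which gives
      B0 v . (v - w) = (B0 v . v - B0 w . w + B0 (v - w) . (v - w)) / 2.
    The last term is nonnegative because the stability condition makes B0
    positive semidefinite ([stable_psd]); the first is at least
    n^2 g(th)^2 / g(t) by the same condition; and B0 w . w = m^2 g(t), since the
    reflection in B0 fixes the direction of angle t. The inequality between the
    arithmetic and geometric means of n^2 g(th)^2 / g(t) and m^2 g(t)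
    concludes.

    To integrate the pointwise inequality, the four integrands are shown to be
    affine on every open element; whatever values they take at the nodes, they
    are then integrable and comparable off a null set
    ([le_Rintegral_pw_affine]). *)

(** * Angles modulo 2 pi *)

Lemma periodic2pi_int (R : realType) (g : R -> R) (t : R) (k : int) :
  periodic2pi g -> g (t + k%:~R * (2 * pi)) = g t.
Proof.
move=> g_per; have gn (n : nat) u : g (u + n%:R * (2 * pi)) = g u.
  elim: n u => [u|n IHn u]; first by rewrite mul0r addr0.
  by rewrite -addn1 natrD mulrDl mul1r addrA g_per IHn.
case: k => n; first exact: gn.
by rewrite -(gn n.+1) NegzE mulrNz mulNr subrK.
Qed.

Lemma periodic2pi_cos (R : realType) : periodic2pi (@cos R).
Proof. by move=> x; rewrite mulr_natl cosD2pi. Qed.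

Lemma periodic2pi_sin (R : realType) : periodic2pi (@sin R).
Proof. by move=> x; rewrite mulr_natl sinD2pi. Qed.

Lemma periodic2pi_derive1 (R : realType) (g : R -> R) :
  periodic2pi g -> periodic2pi (derive1 g).
Proof.
move=> g_per x; rewrite /derive1.
suff -> : (fun h => h^-1 *: (g (h + (x + 2 * pi)) - g (x + 2 * pi))) =
          (fun h => h^-1 *: (g (h + x) - g x)) by [].
by apply/funext => h; rewrite addrA !g_per.
Qed.

Lemma angle_mod2pi (R : realType) (t : R) :
  exists k : int, - pi <= t + k%:~R * (2 * pi) <= pi.
Proof.
have pi0 := @pi_gt0 R; have tpi0 : 0 < 2 * pi :> R by lra.
exists (- Num.floor ((t + pi) / (2 * pi))).
have := floor_le ((t + pi) / (2 * pi)).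
have := floorD1_gt ((t + pi) / (2 * pi)).
rewrite rmorphN intrD /=; set f := (Num.floor _)%:~R; rewrite mulNr.
rewrite ltr_pdivrMr// ler_pdivlMr// => h1 h2.
by apply/andP; split; lra.
Qed.

Lemma polar_form (R : realType) (a b : R) :
  exists rho phi : R, a = rho * cos phi /\ b = rho * sin phi.
Proof.
pose rho := Num.sqrt (a ^+ 2 + b ^+ 2).
have rho2 : rho ^+ 2 = a ^+ 2 + b ^+ 2 by rewrite sqr_sqrtr// addr_ge0// sqr_ge0.
have rho_ge0 : 0 <= rho by exact: sqrtr_ge0.
have [rho0|rhoN0] := eqVneq rho 0.
  exists 0, 0; rewrite !mul0r; split.
  - by apply/eqP; rewrite -sqrf_eq0; move: rho2; rewrite rho0; nra.
  - by apply/eqP; rewrite -sqrf_eq0; move: rho2; rewrite rho0; nra.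
have rho_gt0 : 0 < rho by rewrite lt_neqAle eq_sym rhoN0.
pose c := a / rho.
have aE : a = rho * c by rewrite /c mulrC divfK.
have cB : -1 <= c <= 1.
  by apply/andP; split; rewrite /c ?ler_pdivlMr ?ler_pdivrMr//; nra.
have bE : rho ^+ 2 * (1 - c ^+ 2) = b ^+ 2 by rewrite mulrBr mulr1 -exprMn -aE rho2; ring.
(* acos determines the angle up to sign, which the sign of b then fixes *)
have snE : rho * sin (acos c) = `|b|.
  by rewrite sin_acos// -[X in X * _]ger0_norm// -sqrtr_sqr -sqrtrM ?sqr_ge0// bE sqrtr_sqr.
have cosE : cos (acos c) = c by rewrite acosK// in_itv.
have [b0|b0] := leP 0 b.
  exists rho, (acos c); split; first by rewrite cosE.
  by rewrite snE ger0_norm.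
exists rho, (- acos c); split; first by rewrite cosN cosE.
by rewrite sinN mulrN snE ltr0_norm// opprK.
Qed.

(** * The surface energy matrix as a quadratic form *)

Lemma dotE (R : realType) (u v : 'cV[R]_2) :
  dot u v = u 0 0 * v 0 0 + u 1 0 * v 1 0.
Proof. by rewrite /dot big_ord_recl big_ord1; congr (_ + u _ 0 * v _ 0); exact/val_inj. Qed.

Lemma dotC (R : realType) (u v : 'cV[R]_2) : dot u v = dot v u.
Proof. by rewrite !dotE; congr (_ + _); exact: mulrC. Qed.

Lemma vec2_eta (R : realType) (u : 'cV[R]_2) : u = vec2 (u 0 0) (u 1 0).
Proof.
apply/matrixP => i j; rewrite (ord1 j) mxE.
by case: i => -[|[|//]] /= i2; congr (u _ 0); exact/val_inj.
Qed.

(** Both the product of (g, -g'; g', g) with the reflection and the stabilizing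
    term are symmetric. On the direction of angle t, which the reflection fixes,
    the stabilizing term vanishes and the rotation part g' J is skew, so that
    only g(t) is left. *)
Lemma B0_sym (R : realType) (g S : R -> R) (t : R) :
  exists p q r : R, [/\ forall u v : 'cV[R]_2, dot (B0 g S t *m u) v =
      p * (u 0 0 * v 0 0) + q * (u 1 0 * v 0 0 + u 0 0 * v 1 0)
      + r * (u 1 0 * v 1 0)
    & p * cos t ^+ 2 + q * (2 * cos t * sin t) + r * sin t ^+ 2 = g t].
Proof.
pose c := cos (2 * t); pose s := sin (2 * t).
exists (g t * c - derive1 g t * s + S t * (2^-1 - 2^-1 * c)).
exists (g t * s + derive1 g t * c - S t * (2^-1 * s)).
exists (derive1 g t * s - g t * c + S t * (2^-1 + 2^-1 * c)).
split.
  move=> u v; rewrite dotE /B0 /refl /mat2 !mxE !big_ord_recl !big_ord0 !mxE.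
  rewrite !big_ord_recl !big_ord0 !mxE /= -/c -/s.
  rewrite (_ : lift ord0 ord0 = 1); last exact/val_inj.
  by rewrite !mulr0n !mulr1n; field.
have cs := cos2Dsin2 t.
have cE : c = cos t ^+ 2 - sin t ^+ 2 by rewrite /c mulr_natl mulr2n cosD !expr2.
have sE : s = 2 * cos t * sin t by rewrite /s mulr_natl mulr2n sinD; ring.
rewrite cE sE.
transitivity (g t * (cos t ^+ 2 + sin t ^+ 2) ^+ 2
  + S t / 2 * (1 - (cos t ^+ 2 + sin t ^+ 2)) * (cos t ^+ 2 + sin t ^+ 2)).
  by field.
by rewrite cs; ring.
Qed.

(** The condition is required at all real angles, since the angles of a curve are
    only determined modulo 2 pi. *)
Definition stable (R : realType) (g S : R -> R) := forall t th : R,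
  g th ^+ 2 <= dot ((g t *: B0 g S t) *m vec2 (cos th) (sin th))
                   (vec2 (cos th) (sin th)).

Lemma stable_periodic (R : realType) (g S : R -> R) :
  periodic2pi g -> periodic2pi S ->
  (forall t th : R, - pi <= t <= pi -> - pi <= th <= pi ->
     dot ((g t *: B0 g S t) *m vec2 (cos th) (sin th))
         (vec2 (cos th) (sin th)) >= g th ^+ 2) ->
  stable g S.
Proof.
move=> g_per S_per gS t th.
have [k tk] := angle_mod2pi t; have [l thl] := angle_mod2pi th.
have := gS _ _ tk thl.
have pc := @periodic2pi_cos R; have ps := @periodic2pi_sin R.
have g'_per := periodic2pi_derive1 g_per.
rewrite /B0 /refl (periodic2pi_int _ _ g'_per) !(periodic2pi_int _ _ g_per).
rewrite !(periodic2pi_int _ _ S_per).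
rewrite (periodic2pi_int th l pc) (periodic2pi_int th l ps).
have -> : 2 * (t + k%:~R * (2 * pi)) = 2 * t + (2 * k)%:~R * (2 * pi).
  by rewrite intrM; ring.
by rewrite (periodic2pi_int _ _ pc) (periodic2pi_int _ _ ps).
Qed.

(** Every vector is a multiple of some (cos phi, sin phi), where the form is at
    least g(phi)^2 / g(t). *)
Lemma stable_psd (R : realType) (g S : R -> R) (t : R) (w : 'cV[R]_2) :
  (forall x, 0 < g x) -> stable g S -> 0 <= dot (B0 g S t *m w) w.
Proof.
move=> g_gt0 gS; have [rho [phi [w0 w1]]] := polar_form (w 0 0) (w 1 0).
have := gS t phi; have [p [q [r [B0E _]]]] := B0_sym g S t.
rewrite -scalemxAl B0E w0 w1 dotE !mxE => gphi.
have : 0 <= g t * dot (B0 g S t *m vec2 (cos phi) (sin phi)) (vec2 (cos phi) (sin phi)).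
  apply: (le_trans (sqr_ge0 (g phi))); apply: (le_trans gphi).
  by rewrite dotE !mxE /= mulrDr !mulrA.
rewrite pmulr_rge0// B0E !mxE /= => h.
by have := mulr_ge0 (sqr_ge0 rho) h; rewrite !mulrDr; lra.
Qed.

(** With v = n (cos th, sin th) and w = m (cos t, sin t), symmetry turns
    B0 v . (v - w) into half of B0 v . v - B0 w . w + B0 (v - w) . (v - w); each
    of the three terms is then bounded or computed, and Young's inequality
    absorbs the cross term. *)
Lemma element_energy (R : realType) (g S : R -> R) (t th m n : R) :
  (forall x, 0 < g x) -> stable g S -> 0 < m ->
  n * g th - m * g t <=
    m^-1 * dot (B0 g S t *m (n *: vec2 (cos th) (sin th)))
               (n *: vec2 (cos th) (sin th) - m *: vec2 (cos t) (sin t)).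
Proof.
move=> g_gt0 gS m_gt0.
have := stable_psd t (n *: vec2 (cos th) (sin th) - m *: vec2 (cos t) (sin t)) g_gt0 gS.
have := gS t th.
rewrite -scalemxAl.
have -> (a : R) (u v : 'cV[R]_2) : dot (a *: u) v = a * dot u v.
  by rewrite !dotE !mxE; ring.
have [p [q [r [B0E B0t]]]] := B0_sym g S t.
rewrite !B0E !mxE /= ler_pdivlMl//.
set C := cos th; set D := sin th; move: B0t.
set c := cos t; set s := sin t => B0t.
set Q := _ + r * (D * D) => H1 H2.
have gt0 := g_gt0 t.
have H3 : g th ^+ 2 / g t <= Q by rewrite ler_pdivrMr// mulrC.
(* Young's inequality: the difference is (n g(th) - m g(t))^2 / g(t) *)
have H4 : 2 * n * m * g th - m ^+ 2 * g t <= n ^+ 2 * (g th ^+ 2 / g t).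
  rewrite -subr_ge0.
  have -> : n ^+ 2 * (g th ^+ 2 / g t) - (2 * n * m * g th - m ^+ 2 * g t)
     = (n * g th - m * g t) ^+ 2 / g t by field; rewrite gt_eqF.
  by rewrite divr_ge0 ?sqr_ge0// ltW.
have H5 := ler_wpM2l (sqr_ge0 n) H3.
have H6 : m ^+ 2 * g t = m ^+ 2 * (p * c ^+ 2 + q * (2 * c * s) + r * s ^+ 2).
  by rewrite B0t.
rewrite /Q in H5; nra.
Qed.

(** * Integration of functions affine on the elements *)

Definition elt (R : realType) (J j : nat) : set R := `]node R J j, node R J j.+1[.

(** Nothing is asked at the nodes, where derivatives and angles are arbitrary. *)
Definition pw_affine (R : realType) (J : nat) (f : R -> R) :=
  forall j, (j < J)%N -> affine_on (@elt R J j) f.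

Lemma node0 (R : realType) (J : nat) : node R J 0 = 0.
Proof. by rewrite /node mul0r. Qed.

Lemma nodeJ (R : realType) (J : nat) : (0 < J)%N -> node R J J = 1.
Proof. by move=> J0; rewrite /node divff// pnatr_eq0 -lt0n. Qed.

Lemma node_lt (R : realType) (J i j : nat) :
  (0 < J)%N -> (i < j)%N -> node R J i < node R J j.
Proof. by move=> J0 ij; rewrite /node ltr_pM2r ?invr_gt0 ?ltr0n// ltr_nat. Qed.

Lemma node_le (R : realType) (J i j : nat) :
  (i <= j)%N -> node R J i <= node R J j.
Proof. by move=> ij; rewrite /node ler_wpM2r ?invr_ge0 ?ler0n// ler_nat. Qed.

Lemma off_nodes (R : realType) (J n : nat) (x : R) :
  0 <= x <= node R J n -> (forall j, (j <= n)%N -> x <> node R J j) ->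
  exists2 j, (j < n)%N & @elt R J j x.
Proof.
elim: n => [|n IHn] x0n xN.
  by case: (xN 0%N) => //; move: x0n; rewrite node0 => x0n; lra.
have [xn|nx] := leP x (node R J n).
  have [||j jn jx] := IHn.
  - by case/andP: x0n => ->.
  - by move=> j jn; apply: xN; rewrite leqW.
  - by exists j => //; rewrite leqW.
exists n => //; rewrite /elt /= in_itv /= nx /= lt_neqAle.
by case/andP: x0n => _ ->; rewrite andbT; apply/eqP/xN.
Qed.

Lemma integrable_setU (d : measure_display) (T : measurableType d) (R : realType)
    (mu : {measure set T -> \bar R}) (A B : set T) (f : T -> \bar R) :
  measurable A -> measurable B -> [disjoint A & B]%classic ->
  mu.-integrable A f -> mu.-integrable B f -> mu.-integrable (A `|` B) f.
Proof.
move=> mA mB AB /integrableP[mfA fA] /integrableP[mfB fB].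
have mf : measurable_fun (A `|` B) f by exact/measurable_funU.
apply/integrableP; split=> //.
rewrite ge0_integral_setU//; first exact: lte_add_pinfty.
exact: measurableT_comp.
Qed.

Section integrability.
Context (R : realType).
Notation mu := (@lebesgue_measure R).

Lemma integrable_affine (a b : R) (f : R -> R) :
  affine_on `]a, b[ f -> mu.-integrable `]a, b[ (EFin \o f).
Proof.
move=> [c [d fE]].
apply: (@eq_integrable _ _ _ mu _ _ (EFin \o (fun x => c + d * x))) => //.
  by move=> x; rewrite inE => /= xab; rewrite /= (fE x).
apply: (@integrableS _ _ _ mu `[a, b]) => //; first exact: subset_itv_oo_cc.
apply: continuous_compact_integrable; first exact: segment_compact.
apply: continuous_subspaceT => x.
by apply: cvgD; [exact: cvg_cst|apply: cvgM; [exact: cvg_cst|exact: cvg_id]].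
Qed.

(** The elements are added one by one; each node is a null set, on which any
    value is integrable. *)
Lemma integrable_pw_affine (J : nat) (f : R -> R) :
  (0 < J)%N -> pw_affine J f -> mu.-integrable `[0, 1] (EFin \o f).
Proof.
move=> J0 f_aff.
suff intn n : (n <= J)%N -> mu.-integrable `[0, node R J n] (EFin \o f).
  by have := intn J (leqnn J); rewrite nodeJ.
have int1 (a : R) : mu.-integrable [set a] (EFin \o f).
  apply: null_set_integrable => //; first exact: measurable_fun_set1.
  exact: lebesgue_measure_set1.
elim: n => [_|n IHn nJ]; first by rewrite node0 set_itv1.
have nn := node_lt R J0 (ltnSn n).
have n0 : 0 <= node R J n by rewrite -(node0 R J) node_le.
rewrite (@itv_bndbnd_setU _ _ _ (BRight (node R J n))) ?bnd_simp ?(ltW nn)//.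
rewrite -(@setUitv1 _ _ _ (node R J n.+1) true) ?bnd_simp//.
apply: integrable_setU => //.
- exact: measurableU.
- rewrite disj_set2E; apply/eqP/seteqP; split=> // x [] /=.
  rewrite !in_itv /= => /andP[_ xn] [/andP[nx _]|xE].
    by have := lt_le_trans nx xn; rewrite ltxx.
  by move: xn; rewrite xE leNgt nn.
- exact: IHn (ltnW nJ).
apply: integrable_setU => //.
- rewrite disj_set2E; apply/eqP/seteqP; split=> // x [] /=.
  by rewrite in_itv /= => /andP[_ xn] xE; move: xn; rewrite xE ltxx.
exact/integrable_affine/f_aff.
Qed.

Lemma le_Rintegral_elt (J : nat) (f g : R -> R) :
  (0 < J)%N -> pw_affine J f -> pw_affine J g ->
  (forall j x, (j < J)%N -> @elt R J j x -> f x <= g x) ->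
  \int[mu]_(x in `[0, 1]) f x <= \int[mu]_(x in `[0, 1]) g x.
Proof.
move=> J0 f_aff g_aff fg.
have f_int := integrable_pw_affine J0 f_aff.
have g_int := integrable_pw_affine J0 g_aff.
(* the comparison may fail at the nodes, which are removed from both integrals *)
pose N : set R := node R J @` `I_J.+1.
have N_count : countable N by apply: finite_set_countable; apply: finite_image; exact: finite_II.
have mN : measurable (N : set (measurableTypeR R)) by exact: countable_measurable.
have N0 : mu N = 0%E by exact: countable_lebesgue_measure0.
have mD : measurable (`[0%R, 1%R] `\` N : set (measurableTypeR R)) by exact: measurableD.
have sub : `[0%R, 1%R] `\` N `<=` (`[0%R, 1%R] : set R) by move=> x [].
rewrite /Rintegral (negligible_integral mN _ f_int N0)//.
rewrite (negligible_integral mN _ g_int N0)//.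
apply: (@le_Rintegral _ _ _ mu _ f g) => //.
- exact: integrableS f_int.
- exact: integrableS g_int.
move=> x [/=]; rewrite in_itv /= -(nodeJ R J0) => x01 xN.
have [|j jJ jx] := off_nodes x01; last exact: (fg j).
by move=> j jJ xE; apply: xN; exists j.
Qed.

Lemma le_Rintegral_pw_affine (J : nat) (f g p q : R -> R) : (0 < J)%N ->
  pw_affine J f -> pw_affine J g -> pw_affine J p -> pw_affine J q ->
  (forall j x, (j < J)%N -> @elt R J j x -> f x - g x <= p x + q x) ->
  \int[mu]_(x in `[0, 1]) f x - \int[mu]_(x in `[0, 1]) g x <=
  \int[mu]_(x in `[0, 1]) p x + \int[mu]_(x in `[0, 1]) q x.
Proof.
move=> J0 f_aff g_aff p_aff q_aff fgpq.
rewrite -RintegralB//; [|exact: integrable_pw_affine J0 _..].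
rewrite -RintegralD//; [|exact: integrable_pw_affine J0 _..].
apply: (le_Rintegral_elt J0) => //= j jJ.
- have [a [b fE]] := f_aff j jJ; have [c [d gE]] := g_aff j jJ.
  by exists (a - c), (b - d) => x xj; rewrite fE// gE//; ring.
- have [a [b pE]] := p_aff j jJ; have [c [d qE]] := q_aff j jJ.
  by exists (a + c), (b + d) => x xj; rewrite pE// qE//; ring.
Qed.

End integrability.

(** * Discrete curves on one element *)

Lemma derive1_affine_elt (R : realType) (J j : nat) (X : R -> 'cV[R]_2)
    (u v : 'cV[R]_2) (x : R) :
  (forall y, @elt R J j y -> X y = u + y *: v) -> @elt R J j x ->
  derive1 X x = v.
Proof.
move=> XE xj; rewrite derive1E.
have Xaff : \forall y \near x, X y = u + y *: v.
  near=> y; apply: XE; near: y.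
  exact: (near_in_itvoo xj).
rewrite (near_eq_derive _ Xaff) /derive.
apply/cvg_lim => //; apply: cvg_near_cst; near=> h.
have h0 : h != 0 by near: h; exact: nbhs_dnbhs_neq.
rewrite /= [h%:A]mulr1 scalerDl opprD addrACA subrr add0r addrK.
by rewrite scalerA mulVf// scale1r.
Unshelve. all: by end_near. Qed.

Lemma Kh_sub (R : realType) (J : nat) (f g : R -> R) :
  Kh J f -> Kh J g -> Kh J (fun x => f x - g x).
Proof.
move=> [f_cont f_aff] [g_cont g_aff]; split.
  by move=> x; apply: cvgB; [exact: f_cont|exact: g_cont].
move=> j jJ; have [a [b fE]] := f_aff j jJ; have [c [d gE]] := g_aff j jJ.
by exists (a - c), (b - d) => x xj; rewrite fE// gE//; ring.
Qed.

Lemma Xh_sub (R : realType) (J : nat) (X Y : R -> 'cV[R]_2) :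
  Xh J X -> Xh J Y -> Xh J (fun x => X x - Y x).
Proof.
move=> [rX [zX [zX0 zX1]]] [rY [zY [zY0 zY1]]].
have rE : rcomp (fun x => X x - Y x) = (fun x => rcomp X x - rcomp Y x).
  by apply/funext => x; rewrite /rcomp !mxE.
have zE : zcomp (fun x => X x - Y x) = (fun x => zcomp X x - zcomp Y x).
  by apply/funext => x; rewrite /zcomp !mxE.
split; first by rewrite rE; exact: Kh_sub.
by split; [rewrite zE; exact: Kh_sub|rewrite zE zX0 zX1 zY0 zY1 subrr].
Qed.

(** On an open element an admissible curve is a straight line run at constant
    positive speed [m] in the constant direction of angle [t]. *)
Lemma elt_frame (R : realType) (J j : nat) (X : R -> 'cV[R]_2) (th : R -> R) :
  (j < J)%N -> Xh J X -> admissible J X -> tangent_angle J X th ->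
  exists (u : 'cV[R]_2) (m t : R), 0 < m /\
    forall x, @elt R J j x ->
      [/\ X x = u + x *: (m *: vec2 (cos t) (sin t)),
          derive1 X x = m *: vec2 (cos t) (sin t),
          vnorm (derive1 X x) = m & th x = t].
Proof.
move=> jJ [[_ rX] [[_ zX] _]] [_ X'_gt0] X_th.
have [a [b rE]] := rX j jJ; have [c [d zE]] := zX j jJ.
have XE x : @elt R J j x -> X x = vec2 a c + x *: vec2 b d.
  move=> xj; have xj' : `[node R J j, node R J j.+1]%classic x by exact: subset_itv_oo_cc xj.
  rewrite [LHS]vec2_eta -/(rcomp X x) -/(zcomp X x) rE// zE//.
  by apply/matrixP => i k; rewrite !mxE; case: ifP => _; rewrite mulrC.
have X'E x : @elt R J j x -> derive1 X x = vec2 b d.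
  by move=> xj; exact: derive1_affine_elt XE xj.
have [t tE] := X_th j jJ.
pose m := vnorm (vec2 b d).
have J0 : (0 < J)%N by exact: leq_ltn_trans jJ.
have nn := node_lt R J0 (ltnSn j).
(* t and the direction are constant, so they can be read off at the midpoint *)
pose x0 := (node R J j + node R J j.+1) / 2.
have x0j : node R J j < x0 < node R J j.+1 by rewrite /x0; apply/andP; split; lra.
have x0j' : @elt R J j x0 by rewrite /elt /= in_itv.
have m_gt0 : 0 < m by have := X'_gt0 j x0 jJ x0j; rewrite X'E.
have bdE : vec2 b d = m *: vec2 (cos t) (sin t).
  have [_] := tE x0 x0j; rewrite X'E// => <-.
  by rewrite scalerA divff ?scale1r// gt_eqF.
exists (vec2 a c), m, t; split=> // x xj.
have xj' : node R J j < x < node R J j.+1 by move: xj; rewrite /elt /= in_itv.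
by rewrite -bdE; split; [exact: XE|exact: X'E|rewrite X'E|have [] := tE x xj'].
Qed.

Lemma elt_gt0 (R : realType) (J j : nat) (x : R) :
  (j < J)%N -> @elt R J j x -> 0 < x <= 1.
Proof.
move=> jJ; have J0 : (0 < J)%N by exact: leq_ltn_trans jJ.
rewrite /elt /= in_itv /= => /andP[jx xj]; apply/andP; split.
  by apply: le_lt_trans jx; rewrite -(node0 R J) node_le.
by rewrite -(nodeJ R J0); apply/ltW/(lt_le_trans xj); exact: node_le.
Qed.

(** * The energy estimate *)

(** The right-hand side consists of the surface terms of the second equation of
    the scheme, tested with Y - X. The first of them already contains
    g(thY) (rY - rX) |Y'|, so that on each element the claim reduces to
    [element_energy] multiplied by rX, which is positive there. *)
Lemma surface_energy_estimate (R : realType) (J : nat) (g S : R -> R)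
    (X Y : R -> 'cV[R]_2) (thX thY : R -> R) :
  (0 < J)%N -> (forall x, 0 < g x) -> stable g S ->
  Xh J X -> Xh J Y -> admissible J X -> admissible J Y ->
  tangent_angle J X thX -> tangent_angle J Y thY ->
  ip (rcomp Y) (fun x => g (thY x) * vnorm (derive1 Y x))
  - ip (rcomp X) (fun x => g (thX x) * vnorm (derive1 X x))
  <= ip (fun x => g (thY x))
        (fun x => rcomp (fun y => Y y - X y) x * vnorm (derive1 Y x))
     + ipv (fun x => (rcomp X x *: B0 g S (thX x)) *m derive1 Y x)
         (fun x => (vnorm (derive1 X x))^-1 *: derive1 (fun y => Y y - X y) x).
Proof.
move=> J0 g_gt0 gS XhX XhY admX admY thXP thYP; rewrite /ip /ipv.
(* On element j: rX = a + b x, rY = c + d x, the speeds are m and n, the energy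
     densities k and l, and e is the constant surface term. *)
have elt_data (j : nat) : (j < J)%N -> exists a b c d m n e k l : R,
    forall x, @elt R J j x ->
    [/\ rcomp X x * (g (thX x) * vnorm (derive1 X x)) = (a + b * x) * (k * m),
        rcomp Y x * (g (thY x) * vnorm (derive1 Y x)) = (c + d * x) * (l * n),
        g (thY x) * (rcomp (fun y => Y y - X y) x * vnorm (derive1 Y x)) =
          l * ((c + d * x - (a + b * x)) * n),
        dot ((rcomp X x *: B0 g S (thX x)) *m derive1 Y x)
          ((vnorm (derive1 X x))^-1 *: derive1 (fun y => Y y - X y) x) =
          (a + b * x) * e &
        0 < a + b * x /\ l * n - k * m <= e].
  move=> jJ.
  have [u [m [t [m0 XE]]]] := elt_frame jJ XhX admX thXP.
  have [v [n [s [n0 YE]]]] := elt_frame jJ XhY admY thYP.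
  have D'E x : @elt R J j x -> derive1 (fun y => Y y - X y) x =
      n *: vec2 (cos s) (sin s) - m *: vec2 (cos t) (sin t).
    apply: (@derive1_affine_elt _ _ _ _ (v - u)) => y yj.
    by have [-> _ _ _] := XE y yj; have [-> _ _ _] := YE y yj;
      rewrite scalerBr opprD addrACA.
  exists (u 0 0), (m * cos t), (v 0 0), (n * cos s), m, n.
  exists (m^-1 * dot (B0 g S t *m (n *: vec2 (cos s) (sin s)))
    (n *: vec2 (cos s) (sin s) - m *: vec2 (cos t) (sin t))), (g t), (g s).
  move=> x xj; rewrite (D'E x xj).
  have [X1 X2 X3 X4] := XE x xj; have [Y1 Y2 Y3 Y4] := YE x xj.
  have rX : rcomp X x = u 0 0 + m * cos t * x by rewrite /rcomp X1 !mxE /=; ring.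
  have rY : rcomp Y x = v 0 0 + n * cos s * x by rewrite /rcomp Y1 !mxE /=; ring.
  have rYX : rcomp (fun y => Y y - X y) x = rcomp Y x - rcomp X x.
    by rewrite /rcomp !mxE.
  rewrite rYX X3 X4 Y3 Y4 Y2 -rX -rY; split=> //.
    rewrite -scalemxAl; set w := _ *m _; set z := _ - _.
    by rewrite !dotE !mxE; ring.
  split; last by rewrite ![g _ * _]mulrC; exact: element_energy.
  by case: admX => + _; apply; exact: elt_gt0 xj.
pose F x := rcomp X x * (g (thX x) * vnorm (derive1 X x)).
pose G x := rcomp Y x * (g (thY x) * vnorm (derive1 Y x)).
pose P x := g (thY x) * (rcomp (fun y => Y y - X y) x * vnorm (derive1 Y x)).
pose Q x := dot ((rcomp X x *: B0 g S (thX x)) *m derive1 Y x)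
  ((vnorm (derive1 X x))^-1 *: derive1 (fun y => Y y - X y) x).
rewrite -[leLHS]/(\int[lebesgue_measure]_(x in `[0, 1]) G x
  - \int[lebesgue_measure]_(x in `[0, 1]) F x).
rewrite -[leRHS]/(\int[lebesgue_measure]_(x in `[0, 1]) P x
  + \int[lebesgue_measure]_(x in `[0, 1]) Q x).
have affF : pw_affine J F.
  move=> j /elt_data[a [b [c [d [m [n [e [k [l h]]]]]]]]].
  exists (a * (k * m)), (b * (k * m)) => x /h[] FE _ _ _ _.
  by rewrite /F FE; ring.
have affG : pw_affine J G.
  move=> j /elt_data[a [b [c [d [m [n [e [k [l h]]]]]]]]].
  exists (c * (l * n)), (d * (l * n)) => x /h[] _ GE _ _ _.
  by rewrite /G GE; ring.
have affP : pw_affine J P.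
  move=> j /elt_data[a [b [c [d [m [n [e [k [l h]]]]]]]]].
  exists (l * n * (c - a)), (l * n * (d - b)) => x /h[] _ _ PE _ _.
  by rewrite /P PE; ring.
have affQ : pw_affine J Q.
  move=> j /elt_data[a [b [c [d [m [n [e [k [l h]]]]]]]]].
  exists (a * e), (b * e) => x /h[] _ _ _ QE _.
  by rewrite /Q QE; ring.
apply: (le_Rintegral_pw_affine J0 affG affF affP affQ).
move=> j x jJ xj; have [a [b [c [d [m [n [e [k [l h]]]]]]]]] := elt_data j jJ.
rewrite /F /G /P /Q; have [-> -> -> -> [ab0 le]] := h x xj.
have := ler_wpM2l (ltW ab0) le; nra.
Qed.

(* X, Y are the curves at levels m, m+1 and thX, thY their angles. *)
Theorem theorem4p2 (R : realType) (J : nat) (gamma S : R -> R)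
    (eta sigma dt : R) (X Y : R -> 'cV[R]_2) (mu thX thY : R -> R)
  (J_gt0 : (0 < J)%N)
  (gammaP : surface_energy_density gamma)
  (SP : periodic2pi S)
  (B0P : forall t th : R, - pi <= t <= pi -> - pi <= th <= pi ->
     dot ((gamma t *: B0 gamma S t) *m vec2 (cos th) (sin th))
         (vec2 (cos th) (sin th)) >= gamma th ^+ 2)
  (eta_gt0 : 0 < eta) (dt_gt0 : 0 < dt)
  (XhX : Xh J X) (XhY : Xh J Y) (Khmu : Kh J mu)
  (admX : admissible J X) (admY : admissible J Y)
  (thXP : tangent_angle J X thX) (thYP : tangent_angle J Y thY)
  (scheme1 : forall phi : R -> R, Kh J phi ->
     dt^-1 * ipv (fun x => Y x - X x) (fun x => phi x *: fhalf X Y x)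
     - ip (fun x => rcomp X x * derive1 mu x)
          (fun x => derive1 phi x * (vnorm (derive1 X x))^-1) = 0)
  (scheme2 : forall psi : R -> 'cV[R]_2, Xh J psi ->
     ipv (fun x => mu x *: fhalf X Y x) psi
     + ip (fun x => gamma (thY x)) (fun x => rcomp psi x * vnorm (derive1 Y x))
     + ipv (fun x => (rcomp X x *: B0 gamma S (thX x)) *m derive1 Y x)
           (fun x => (vnorm (derive1 X x))^-1 *: derive1 psi x)
     + (2 * eta * dt)^-1 *
         ((rcomp Y 1 + rcomp X 1) * (rcomp Y 1 - rcomp X 1) * rcomp psi 1
          + (rcomp Y 0 + rcomp X 0) * (rcomp Y 0 - rcomp X 0) * rcomp psi 0)
     - sigma / 2 *
         ((rcomp Y 1 + rcomp X 1) * rcomp psi 1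
          - (rcomp Y 0 + rcomp X 0) * rcomp psi 0) = 0) :
  energy gamma sigma Y thY
  + 2 * pi * dt * ip (fun x => rcomp X x * (derive1 mu x) ^+ 2)
                     (fun x => (vnorm (derive1 X x))^-1)
  + pi / (eta * dt) *
      ((rcomp Y 1 + rcomp X 1) * (rcomp Y 1 - rcomp X 1) ^+ 2
       + (rcomp Y 0 + rcomp X 0) * (rcomp Y 0 - rcomp X 0) ^+ 2)
  <= energy gamma sigma X thX.
Proof.
have [g_gt0 _ _ g_per] := gammaP.
have est := surface_energy_estimate J_gt0 g_gt0 (stable_periodic g_per SP B0P)
  XhX XhY admX admY thXP thYP.
have eq1 := scheme1 mu Khmu.
have eq2 := scheme2 _ (Xh_sub XhY XhX).
have KC : ipv (fun x => mu x *: fhalf X Y x) (fun x => Y x - X x) =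
            ipv (fun x => Y x - X x) (fun x => mu x *: fhalf X Y x).
  by rewrite /ipv; apply: eq_Rintegral => x _; exact: dotC.
have dissE : ip (fun x => rcomp X x * derive1 mu x)
                (fun x => derive1 mu x * (vnorm (derive1 X x))^-1) =
             ip (fun x => rcomp X x * (derive1 mu x) ^+ 2)
                (fun x => (vnorm (derive1 X x))^-1).
  by rewrite /ip; apply: eq_Rintegral => x _; rewrite expr2 !mulrA.
have rYX x : rcomp (fun y => Y y - X y) x = rcomp Y x - rcomp X x.
  by rewrite /rcomp !mxE.
rewrite KC !rYX in eq2; rewrite dissE in eq1.
rewrite /energy; move: eq1 eq2 est.
set K := ipv _ (fun x => mu x *: _).
set D := ip (fun x => rcomp X x * _ ^+ 2) _.
set P := ip (fun x => gamma _) _; set Q := ipv _ _.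
set WY := ip (rcomp Y) _; set WX := ip (rcomp X) _.
set y1 := rcomp Y 1; set x1 := rcomp X 1; set y0 := rcomp Y 0; set x0 := rcomp X 0.
move=> eq1 eq2 est.
have KE : K = dt * D.
  apply: (mulfI (invr_neq0 (lt0r_neq0 dt_gt0))); rewrite mulKf ?gt_eqF//.
  by apply/eqP; rewrite -subr_eq0 eq1.
rewrite KE in eq2.
have tpi_ge0 : 0 <= 2 * pi :> R by rewrite mulr_ge0 ?pi_ge0.
have := ler_wpM2l tpi_ge0 est.
have := congr1 ( *%R (2 * pi)) eq2.
have -> : (2 * eta * dt)^-1 = (eta * dt)^-1 / 2 by field; rewrite !gt_eqF.
set w := (eta * dt)^-1; rewrite mulr0 => eq3 est2.
lra.
Qed.
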